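(* The proof systems Cutting Planes ($\mathsf{CP}$) and Facelike Stabbing Planes (Facelike $\mathsf{SP}$) are polynomially equivalent: for every unsatisfiable system of integer linear inequalities, a refutation of size $s$ in either system can be converted into a refutation of the same system in the other of size polynomial in $s$.
   Context: Cutting Planes ($\mathsf{CP}$): given a system of linear inequalities with integer coefficients over $x\in\mathbb{R}^n$, a $\mathsf{CP}$ proof is a sequence of integer linear inequalities, each either in the system or deduced from earlier ones by (i) Linear combination: any nonnegative integer linear combination of two earlier inequalities; or (ii) Division: from $ax\le b$, if a positive integer $d$ divides all entries of $a$, deduce $(a/d)x\le\lfloor b/d\rfloor$. A refutation is a proof of $0\ge 1$ (i.e. $1\le 0$); its size is the number of lines. Stabbing Planes ($\mathsf{SP}$): a refutation of an unsatisfiable system $F$ of linear inequalities is a directed binary tree in which each internal node is labelled by a query $(ax\le b-1,\ ax\ge b)$ with $a\in\mathbb{Z}^n$, $b\in\mathbb{Z}$, the two outgoing edges being labelled by these two inequalities; each node corresponds to the polytope $P$ defined by $F$ together with the inequalities on the path from the root to the node; each leaf is labelled by a nonnegative linear combination of inequalities of $F$ and of the inequalities on its root path yielding $0\ge 1$. Size is the size of the tree (number of queries, polynomially equivalent to bit-length for the systems considered). A face of a polytope $P$ is a set $P\cap\{x: cx=\delta\}$ where $\delta=\max\{cx: x\in P\}$. A query $(ax\le b-1, ax\ge b)$ at a node with polytope $P$ is facelike if one of $P\cap\{x: ax\le b-1\}$, $P\cap\{x: ax\ge b\}$ is empty or a face of $P$. Facelike $\mathsf{SP}$ consists of $\mathsf{SP}$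 refutations all of whose queries are facelike.
   Formalization: From Facelike SP to CP the size is polynomial in s + min(n, m), with n variables and m inequalities, instead of s: with size the number of queries, x_1≤0, x_{i+1}≤x_i, x_n≥1 has a 0-query SP refutation, but every CP refutation needs n+1 lines. *)

(* Defs.v *)
From HB Require Import structures.
From mathcomp Require Import all_boot all_order all_algebra.
From mathcomp Require Import classical_sets reals.

Set Implicit Arguments.
Unset Strict Implicit.
Unset Printing Implicit Defensive.

Import Order.TTheory GRing.Theory Num.Theory.
Local Open Scope ring_scope.
Local Open Scope classical_set_scope.

(* [l : ineq n] stands for the inequality l.1 x <= l.2; an inequality a x >= b
   is written (- a, - b). *)
Definition ineq (n : nat) : Type := ('rV[int]_n * int)%type.

Definition system (n : nat) : Type := seq (ineq n).

(* Unsatisfiable over the integers, the notion refuted by both proof systems;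
   the real relaxation of such a system may well be nonempty. *)
Definition unsatisfiable (n : nat) (F : system n) : Prop :=
  ~ exists x : 'cV[int]_n, forall l : ineq n, l \in F -> (l.1 *m x) 0 0 <= l.2.

Section CuttingPlanes.
Variable n : nat.
Implicit Types (F prev pi : seq (ineq n)) (l : ineq n).

Definition linear_combination prev l : Prop :=
  exists (l1 l2 : ineq n) (j k : nat),
    [/\ l1 \in prev, l2 \in prev &
        l = (l1.1 *+ j + l2.1 *+ k, l1.2 *+ j + l2.2 *+ k)].

(* [(b %/ d)%Z] is the floor of b / d, since 0 < d. *)
Definition division prev l : Prop :=
  exists (l1 : ineq n) (d : int),
    [/\ l1 \in prev, 0 < d, forall i, (d %| l1.1 0%R i)%Z &
        l = (\row_i (l1.1 0%R i %/ d)%Z, (l1.2 %/ d)%Z)].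

Inductive cp_proof F : seq (ineq n) -> Prop :=
| cp_nil : cp_proof F [::]
| cp_rcons pi l :
    cp_proof F pi ->
    l \in F \/ linear_combination pi l \/ division pi l ->
    cp_proof F (rcons pi l).

(* The last line is 0 x <= -1, that is, 1 <= 0. *)
Definition cp_refutation F pi : Prop :=
  cp_proof F pi /\ exists pi', pi = rcons pi' (0, -1).

Definition cp_size pi : nat := size pi.

End CuttingPlanes.

Section StabbingPlanes.
Variables (R : realType) (n : nat).
Implicit Types (F G : system n) (P Q : set 'cV[R]_n).

(* The left subtree of [sp_query a b] is reached through a x <= b - 1 and the
   right one through a x >= b. A leaf carries the coefficients of its linear
   combination, listed in the order of the inequalities at that leaf: those of
   the system followed by those of the root path. *)
Inductive sp_tree : Type :=
| sp_leaf of seq R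
| sp_query of 'rV[int]_n & int & sp_tree & sp_tree.

Fixpoint sp_size (t : sp_tree) : nat :=
  match t with
  | sp_leaf _ => 0%N
  | sp_query _ _ t1 t2 => (sp_size t1 + sp_size t2).+1
  end.

Definition lhs (a : 'rV[int]_n) (x : 'cV[R]_n) : R :=
  (map_mx intr a *m x) 0 0.

(* A polyhedron: boundedness is not required. *)
Definition polytope G : set 'cV[R]_n :=
  [set x | forall l : ineq n, l \in G -> lhs l.1 x <= l.2%:~R].

Definition is_face P Q : Prop :=
  exists (c : 'rV[R]_n) (delta : R),
    [/\ exists2 x, P x & (c *m x) 0 0 = delta,
        forall x, P x -> (c *m x) 0 0 <= delta &
        Q = P `&` [set x | (c *m x) 0 0 = delta]].

Definition facelike_query P (a : 'rV[int]_n) (b : int) : Prop :=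
  let P1 := P `&` [set x | lhs a x <= (b - 1)%:~R] in
  let P2 := P `&` [set x | b%:~R <= lhs a x] in
  (P1 = set0 \/ is_face P P1) \/ (P2 = set0 \/ is_face P P2).

Definition leaf_valid G (w : seq R) : Prop :=
  [/\ size w = size G,
      forall i, (i < size G)%N -> 0 <= w`_i,
      \sum_(i < size G) w`_i *: map_mx intr (nth (0, 0) G i).1
        = 0 :> 'rV[R]_n &
      \sum_(i < size G) w`_i * (nth (0, 0) G i).2%:~R = -1].

(* In the next two fixpoints [G] is the system at the current node: the
   refuted system extended by the inequalities on the root path. *)
Fixpoint sp_valid G (t : sp_tree) : Prop :=
  match t with
  | sp_leaf w => leaf_valid G w
  | sp_query a b t1 t2 =>
      sp_valid (rcons G (a, b - 1)) t1 /\ sp_valid (rcons G (- a, - b)) t2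
  end.

Fixpoint facelike G (t : sp_tree) : Prop :=
  match t with
  | sp_leaf _ => True
  | sp_query a b t1 t2 =>
      [/\ facelike_query (polytope G) a b,
          facelike (rcons G (a, b - 1)) t1 &
          facelike (rcons G (- a, - b)) t2]
  end.

Definition facelike_sp_refutation F (t : sp_tree) : Prop :=
  sp_valid F t /\ facelike F t.

End StabbingPlanes.

(* Main.v *)
Require Import Defs.
From mathcomp Require Import all_boot all_order all_algebra.
From mathcomp Require Import classical_sets reals.
From mathcomp Require Import boolp lra zify.

(* From CP to SP: only a division [a x <= b |- (a / d) x <= floor (b / d)] calls
   for a query; the other side of it is empty, hence facelike, and a leaf.

   From SP to CP: a facelike query [(a, b)] on a polytope [P] forces [a x <= b]
   or [a x >= b - 1] throughout [P]. Say the former. By Farkas' lemma and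
   Caratheodory's theorem, [a x <= b] is a combination of few inequalities
   followed by a division. The right subtree refutes [P] with [a x >= b], and
   its CP refutation lifts to a derivation of [a x <= b - 1] from [P], which is
   the additional inequality of the left subtree. Lifting costs one line per
   division, and the number of divisions is linear in the size of the tree. *)

Set Implicit Arguments.
Unset Strict Implicit.
Unset Printing Implicit Defensive.

Import Order.TTheory GRing.Theory Num.Theory.
Local Open Scope ring_scope.
Local Open Scope classical_set_scope.

(** * Finitely generated cones over an ordered field *)

(** Induction on the number of generators: if the functional [c] separating [b] from the tail is
    negative on the new generator [v], everything is projected along [v] onto the kernel of [c]. *)
Lemma farkas (F : realFieldType) m (s : seq 'rV[F]_m) (b : 'rV[F]_m) :
  (exists2 w : nat -> F, forall i, 0 <= w i &
     b = \sum_(i < size s) w i *: s`_i) \/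
  (exists2 c : 'cV[F]_m, forall a, a \in s -> 0 <= (a *m c) 0 0 &
     (b *m c) 0 0 < 0).
Proof.
elim: {s}(size s) {-2}s (erefl (size s)) b => [|k IHk] [|v s] //= sz_s b.
  have [-> | b_neq0] := eqVneq b 0.
    by left; exists (fun=> 0) => //; rewrite big_ord0.
  right; exists (- b^T) => //; rewrite mulmxN mxE oppr_lt0 mxE lt_def.
  have b2_ge0 i : 0 <= b 0 i * b^T i 0 by rewrite mxE -expr2 sqr_ge0.
  rewrite sumr_ge0 // andbT; apply: contra b_neq0 => /eqP/psumr_eq0P b0.
  apply/eqP/rowP=> i; have /eqP := b0 (fun i _ => b2_ge0 i) i isT.
  by rewrite !mxE mulf_eq0 orbb => /eqP.
have {sz_s} [sz_s] := sz_s.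
have [[w w_ge0 ->]|[c c_s c_b]] := IHk s sz_s b.
  left; exists (fun i => if i is j.+1 then w j else 0); first by case.
  by rewrite big_ord_recl scale0r add0r.
have [c_v|c_v] := leP 0 ((v *m c) 0 0).
  right; exists c => // a; rewrite inE => /predU1P[->//|]; exact: c_s.
pose mu (a : 'rV[F]_m) := (a *m c) 0 0 / (v *m c) 0 0.
pose proj a := a - mu a *: v.
have [|[w w_ge0 b_w]|[d d_s d_b]] := IHk (map proj s) _ (proj b).
- by rewrite size_map.
(* The weight of [v] is nonnegative: [c] is negative on [b] and [v] but nonnegative on [s], so
   [mu b] is positive and each [mu s_i] is at most 0. *)
- left; exists (fun i => if i is j.+1 then w j
                 else mu b - \sum_(i < size s) w i * mu s`_i).
    case=> // ; rewrite subr_ge0 (@le_trans _ _ 0) //.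
      apply: sumr_le0 => i _; apply: mulr_ge0_le0 => //.
      by rewrite mulr_ge0_le0 ?invr_le0 ?(ltW c_v) // c_s ?mem_nth.
    by rewrite mulr_le0 ?invr_le0 ?ltW.
  rewrite big_ord_recl /= -[LHS](subrK (mu b *: v)) -/(proj b) b_w size_map.
  rewrite scalerBl scaler_suml -addrA addrC; congr (_ + _).
  rewrite addrC -sumrN -big_split; apply: eq_bigr => i _ /=.
  by rewrite (nth_map 0) // scalerBr scalerA addrC.
(* Subtracting [r *: c] makes the functional vanish on [v]; its value on any [a] is that of [d] on
   [proj a]. *)
- pose r := (v *m d) 0 0 / (v *m c) 0 0.
  have projE a : (a *m (d - r *: c)) 0 0 = (proj a *m d) 0 0.
    rewrite mulmxBr mulmxBl -scalemxAl -scalemxAr.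
    rewrite [LHS]mxE [X in _ + X]mxE [X in _ + - X]mxE.
    rewrite [RHS]mxE [X in _ = _ + X]mxE [X in _ = _ + - X]mxE.
    by rewrite /mu /r mulrC (mulrC ((v *m d) 0 0)) mulrA.
  right; exists (d - r *: c) => [a|]; rewrite projE //.
  rewrite inE => /predU1P[->|a_s]; last exact: d_s (map_f _ a_s).
  by rewrite /proj /mu divff ?lt_eqF // scale1r subrr mul0mx mxE.
Qed.

(** More than [m] vectors satisfy a linear relation [z]; subtracting it with the least ratio
    [w i / z i] over [z i > 0] kills one weight and keeps the others nonnegative. *)
Lemma caratheodory (F : realFieldType) m k (w : 'I_k -> F)
    (v : 'I_k -> 'rV[F]_m) :
  (forall i, 0 <= w i) ->
  exists j (u : 'I_j -> F) (h : 'I_j -> 'I_k),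
    [/\ (j <= m)%N, (j <= k)%N, forall i, 0 <= u i &
        \sum_i w i *: v i = \sum_i u i *: v (h i)].
Proof.
elim: k w v => [|k IHk] w v w_ge0.
  by exists 0%N, w, id.
have [k_m|m_k] := leqP k.+1 m; first by exists k.+1, w, id.
have [z zV [i z_i]] : exists2 z : 'rV[F]_k.+1,
    \sum_i z 0 i *: v i = 0 & exists i, 0 < z 0 i.
  pose V := \matrix_i v i.
  have /rowV0Pn[z /sub_kermxP zV z_neq0] : kermx V != 0.
    rewrite -mxrank_eq0 mxrank_ker subn_eq0 -ltnNge.
    exact: leq_ltn_trans (rank_leq_col V) m_k.
  have zV0 : \sum_i z 0 i *: v i = 0.
    by rewrite -[RHS]zV mulmx_sum_row; apply: eq_bigr => i _; rewrite rowK.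
  have /existsP[i z_i] : [exists i, z 0 i != 0].
    apply: contraNT z_neq0; rewrite negb_exists => /forallP z0.
    by apply/eqP/rowP=> i; rewrite mxE; apply/eqP/negbNE/z0.
  have [z_lt0|z_ge0] := ltP (z 0 i) 0; last first.
    by exists z; last exists i; rewrite // lt_def z_i.
  exists (- z); last by exists i; rewrite mxE oppr_gt0.
  rewrite -[RHS]oppr0 -[X in _ = - X]zV0 -sumrN; apply: eq_bigr => j _.
  by rewrite mxE scaleNr.
case: (@arg_minP _ F _ i (fun i => 0 < z 0 i) (fun i => w i / z 0 i) z_i).
move=> i0 z_i0 min_i0; pose r := w i0 / z 0 i0.
have r_ge0 : 0 <= r by rewrite divr_ge0 // ltW.
have [|j [u [h [jm jk u_ge0 e]]]] :=
  IHk (fun i => w (lift i0 i) - r * z 0 (lift i0 i)) (fun i => v (lift i0 i)).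
  move=> l; set i' := lift i0 l; rewrite subr_ge0.
  have [z_i'|z_i'] := ltP 0 (z 0 i').
    by rewrite -ler_pdivlMr // min_i0.
  by apply: le_trans (w_ge0 i'); rewrite mulr_ge0_le0.
exists j, u, (fun i => lift i0 (h i)); split => //; first exact: leqW.
rewrite -e -[LHS]subr0 -[X in _ - X](scaler0 _ r) -[X in r *: X]zV.
rewrite scaler_sumr -sumrB.
rewrite (bigD1_ord i0) //= scalerA divfK ?gt_eqF // subrr add0r.
by apply: eq_bigr => l _; rewrite scalerA -scalerBl.
Qed.

Lemma common_denominator k (w : 'I_k -> rat) : (forall i, 0 <= w i) ->
  exists (D : nat) (N : 'I_k -> nat), (0 < D)%N /\
    forall i, D%:R * w i = (N i)%:R.
Proof.
move=> w_ge0; pose d i := `|denq (w i)|%N.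
exists (\prod_i d i)%N, (fun i => (`|numq (w i)| * \prod_(j | j != i) d j)%N).
split=> [|i]; first by rewrite prodn_gt0 // => i; rewrite absz_gt0 denq_eq0.
rewrite (bigD1 i) //= !natrM mulrAC; congr (_ * _).
rewrite -[w i in LHS]divq_num_den mulrC /d !natr_absz.
rewrite !ger0_norm ?numq_ge0 ?denq_ge0 // mulfVK ?intr_eq0 ?denq_neq0 //.
Qed.

(** * Cutting Planes derivations, with divisions counted apart *)

Section CuttingPlanesDerivations.
Variable n : nat.
Implicit Types (G H : system n) (pi : seq (ineq n)) (l : ineq n).
Implicit Types (a : 'rV[int]_n) (b : int).

Inductive cp_derivation G : nat -> seq (ineq n) -> Prop :=
| cpd_nil : cp_derivation G 0 [::]
| cpd_rcons d pi l : cp_derivation G d pi ->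
    l \in G \/ linear_combination pi l -> cp_derivation G d (rcons pi l)
| cpd_div d pi l : cp_derivation G d pi ->
    division pi l -> cp_derivation G d.+1 (rcons pi l).

Lemma cp_derivation_proof G d pi : cp_derivation G d pi -> cp_proof G pi.
Proof.
elim=> [|{}d {}pi l _ IH [lG|comb]|{}d {}pi l _ IH div]; first exact: cp_nil.
- by apply: cp_rcons => //; left.
- by apply: cp_rcons => //; right; left.
- by apply: cp_rcons => //; right; right.
Qed.

(* Cutting Planes cannot weaken a right-hand side, so that a derivation may
   only reach an inequality stronger than the intended one. *)
Definition has_stronger pi l :=
  exists2 l', l' \in pi & l'.1 = l.1 /\ l'.2 <= l.2.

Lemma has_stronger_mem pi l : l \in pi -> has_stronger pi l.
Proof. by exists l. Qed.

Lemma has_stronger_sub pi pi' l :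
  {subset pi <= pi'} -> has_stronger pi l -> has_stronger pi' l.
Proof. by move=> sub [l' /sub l'_pi' le_l]; exists l'. Qed.

Lemma sub_rcons pi l : {subset pi <= rcons pi l}.
Proof. by move=> l' l'_pi; rewrite mem_rcons inE l'_pi orbT. Qed.

Lemma mem_rcons_last pi l : l \in rcons pi l.
Proof. by rewrite mem_rcons mem_head. Qed.

Lemma derive_combination G d pi l1 l2 j k :
  cp_derivation G d pi -> has_stronger pi l1 -> has_stronger pi l2 ->
  exists2 l, cp_derivation G d (rcons pi l) &
    has_stronger (rcons pi l)
      (l1.1 *+ j + l2.1 *+ k, l1.2 *+ j + l2.2 *+ k).
Proof.
move=> piG [l1' l1'_pi [<- le1]] [l2' l2'_pi [<- le2]].
exists (l1'.1 *+ j + l2'.1 *+ k, l1'.2 *+ j + l2'.2 *+ k).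
  by apply: cpd_rcons => //; right; exists l1', l2', j, k.
exists (l1'.1 *+ j + l2'.1 *+ k, l1'.2 *+ j + l2'.2 *+ k).
  exact: mem_rcons_last.
by split=> //=; apply: lerD; apply: ler_wMn2r.
Qed.

Lemma derive_quotient G d pi (e : int) a b :
  cp_derivation G d pi -> 0 < e -> has_stronger pi (e *: a, b) ->
  exists2 l, cp_derivation G d.+1 (rcons pi l) &
    has_stronger (rcons pi l) (a, (b %/ e)%Z).
Proof.
move=> piG e_gt0 [l' l'_pi /= [l'1 le_b]].
exists (a, (l'.2 %/ e)%Z).
  apply: cpd_div => //; exists l', e; split=> // [i|].
    by rewrite l'1 mxE dvdz_mulr.
  congr (_, _); apply/rowP => i.
  by rewrite mxE l'1 mxE mulKz // gt_eqF.
exists (a, (l'.2 %/ e)%Z); first exact: mem_rcons_last.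
by split=> //=; apply: lez_pdiv2r => //; apply: ltW.
Qed.

(* A line [c x <= e] derived with the help of the hypotheses [H] becomes
   [(c + K a) x <= e + K b] for some [K]; before a division by [d], adding a
   multiple of [a x <= b] makes [K] divisible by [d]. Only divisions cost an
   additional line, and their number does not grow, so that nested liftings
   remain polynomial. *)
Lemma lift_derivation G H d0 pi0 a b :
  cp_derivation G d0 pi0 -> has_stronger pi0 (a, b) ->
  (forall l, l \in H ->
     l \in G \/ exists K, has_stronger pi0 (l.1 + a *+ K, l.2 + b *+ K)) ->
  forall d pi, cp_derivation H d pi ->
  exists pi', [/\ cp_derivation G (d0 + d) pi', {subset pi0 <= pi'},
    (size pi' <= size pi0 + size pi + d)%N &
    forall l, l \in pi ->
      exists K, has_stronger pi' (l.1 + a *+ K, l.2 + b *+ K)].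
Proof.
move=> pi0G ab HG d pi; elim=> {d pi} [|d pi l _ [pi' [pi'G sub sz IH]] Hl|
    d pi l _ [pi' [pi'G sub sz IH]] [l1 [e [l1_pi e_gt0 dvd_e ->]]]].
- by exists pi0; rewrite !addn0; split.
- have keep pi'' : {subset pi' <= pi''} ->
    (exists K, has_stronger pi'' (l.1 + a *+ K, l.2 + b *+ K)) ->
    forall l', l' \in rcons pi l ->
    exists K, has_stronger pi'' (l'.1 + a *+ K, l'.2 + b *+ K).
    move=> sub' l_pi'' l'; rewrite mem_rcons inE => /predU1P[-> //|/IH[K lK]].
    by exists K; apply: has_stronger_sub lK.
  case: Hl => [/HG[lG|[K lK]]|[l1 [l2 [j [k [/IH[K1 lK1] /IH[K2 lK2] lE]]]]]].
  + exists (rcons pi' l); split=> [|l' /sub|| ].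
    * by apply: cpd_rcons => //; left.
    * exact: sub_rcons.
    * by rewrite !size_rcons; lia.
    * apply: keep; first exact: sub_rcons.
      exists 0%N; rewrite !mulr0n !addr0; apply: has_stronger_mem.
      by rewrite -surjective_pairing mem_rcons_last.
  + exists pi'; split=> //; first by rewrite size_rcons; lia.
    by apply: keep => //; exists K; apply: has_stronger_sub lK.
  + have [l' l'G l'_st] := derive_combination j k pi'G lK1 lK2.
    exists (rcons pi' l'); split=> // [l'' /sub||].
    * exact: sub_rcons.
    * by rewrite !size_rcons; lia.
    * apply: keep; first exact: sub_rcons.
      exists (K1 * j + K2 * k)%N; rewrite lE /=; move: l'_st => /=.
      rewrite !mulrnDl -!mulrnA (addrACA (l1.1 *+ j)).
      by rewrite (addrACA (l1.2 *+ j)) -!mulrnDr.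
- have [K lK] := IH _ l1_pi.
  have ab' : has_stronger pi' (a, b) by apply: has_stronger_sub ab.
  (* The K copies of a x <= b become e K; dividing by e takes them back to exactly K, with no effect
     on the rounding of [l1.2]. *)
  have [l2 l2G l2_st] := derive_combination 1 (`|e|.-1 * K) pi'G lK ab'.
  have [|l3 l3G l3_st] := @derive_quotient _ _ _ e
    (\row_i (l1.1 0%R i %/ e)%Z + a *+ K) (l1.2 + b *+ (`|e| * K)) l2G e_gt0.
    case: l2_st => l2' l2'_in /= [l2'1 l2'2]; exists l2' => //=.
    have eK : (`|e| * K)%N = (K + `|e|.-1 * K)%N.
      by rewrite -mulSn prednK // absz_gt0 gt_eqF.
    rewrite l2'1 eK mulrnDr addrA; split=> //; rewrite !mulr1n -addrA -mulrnDr.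
    rewrite -eK scalerDr; congr (_ + _).
      by apply/rowP=> i; rewrite !mxE mulrC divzK.
    by rewrite mulnC mulrnA -scaler_nat natz gtz0_abs.
  exists (rcons (rcons pi' l2) l3); split=> [|l' /sub l'_in||l'].
  + by rewrite addnS.
  + by do 2!apply: sub_rcons.
  + by rewrite !size_rcons; lia.
  rewrite mem_rcons inE => /predU1P[->|/IH[K' l'K']]; last first.
    by exists K'; apply: has_stronger_sub l'K' => l'' ?; do 2!apply: sub_rcons.
  exists K; move: l3_st => /=; suff -> : ((l1.2 + b *+ (`|e| * K)) %/ e)%Z =
    (l1.2 %/ e)%Z + b *+ K by [].
  rewrite mulnC mulrnA -mulr_natr natz gtz0_abs // divzDr ?dvdz_mull //.
  by rewrite mulzK // gt_eqF.
Qed.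

(** * Cutting Planes derivations of implied inequalities *)

(** Terms [(0, 1)] are dropped, since they only weaken the right-hand side. The line [g] serves to
    produce 0 <= 0 for the empty sum. *)
Lemma derive_sum G g (s : seq (nat * ineq n)) : g \in G ->
  (forall x, x \in s -> x.2 \in G \/ x.2 = (0, 1)) ->
  exists pi, [/\ cp_derivation G 0 pi, (size pi <= (size s).*2 + 2)%N &
    has_stronger pi
      (\sum_(x <- s) x.2.1 *+ x.1, \sum_(x <- s) x.2.2 *+ x.1)].
Proof.
move=> gG; elim: s => [|[k l] s IH] Gs.
  exists [:: g; (0, 0)]; rewrite !big_nil; split=> //.
    apply: (@cpd_rcons _ _ [:: g]).
      by apply: (@cpd_rcons _ _ [::]); [exact: cpd_nil | left].
    right; exists g, g, 0%N, 0%N; split; rewrite ?mem_head //.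
    by rewrite !mulr0n !addr0.
  by apply: has_stronger_mem; rewrite !inE eqxx orbT.
have [x x_s|pi [piG sz st]] := IH; first by apply: Gs; rewrite inE x_s orbT.
rewrite !big_cons /=.
have [/= lG|/= ->] := Gs _ (mem_head _ _); last first.
  exists pi; split=> //; first by rewrite /=; lia.
  case: st => l' l'_pi /= [l'1 l'2]; exists l' => //=; rewrite mul0rn add0r.
  by split=> //; apply: le_trans l'2 _; rewrite lerDr mulrn_wge0.
have pilG : cp_derivation G 0 (rcons pi l) by apply: cpd_rcons => //; left.
have [l' l'G l'_st] := derive_combination k 1 pilG
  (has_stronger_mem (mem_rcons_last pi l))
  (has_stronger_sub (@sub_rcons pi l) st).
exists (rcons (rcons pi l) l'); split=> //.
by rewrite !size_rcons /=; lia.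
Qed.

(** Homogenization, which turns implication into membership in a cone. Rational entries allow the
    multipliers to be cleared of denominators. *)
Definition ineq_row (l : ineq n) : 'rV[rat]_(n + 1) :=
  row_mx (map_mx intr l.1) (l.2%:~R)%:M.

(* The generator [(0, 1)], for [0 <= 1], accounts for a slack in [b]. *)
Lemma derive_cone G g a b (w : nat -> rat) : g \in G ->
  (forall i, 0 <= w i) ->
  ineq_row (a, b) =
    \sum_(i < (size G).+1) w i *: (map ineq_row ((0, 1) :: G))`_i ->
  exists pi, [/\ cp_derivation G 1 pi, (size pi <= (minn n (size G)).*2 + 5)%N &
    has_stronger pi (a, b)].
Proof.
move=> gG w_ge0; set s := (0, 1) :: G.
under eq_bigr => i _ do rewrite (nth_map (0, 0)) //.
(* In dimension n + 1, [minn n (size G) + 1] terms suffice: two lines for each, two more for the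
   empty sum, and one division by the common denominator [D]. *)
have [k [u [h [k_n k_G u_ge0 ->]]]] :=
  caratheodory (fun i : 'I_(size G).+1 => ineq_row (nth (0, 0) s i))
    (fun i => w_ge0 i).
have [D [N [D_gt0 DN]]] := common_denominator u_ge0.
move=> ab; pose m i : nat * ineq n := (N i, nth (0, 0) s (h i)).
have aE : \sum_i (m i).2.1 *+ (m i).1 = D%:Z *: a.
  apply/rowP=> j; apply: (@intr_inj rat).
  have /(congr1 (fun v : 'rV_(n + 1) => D%:R * v 0 (lshift 1 j))) := ab.
  rewrite summxE [in LHS]/ineq_row row_mxEl mxE => abj.
  rewrite mxE rmorphM /= -[D%:~R]pmulrn abj summxE mulr_sumr rmorph_sum.
  apply: eq_bigr => i _.
  by rewrite mulmxnE rmorphMn /= mxE row_mxEl mxE mulrA DN mulr_natl.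
have bE : \sum_i (m i).2.2 *+ (m i).1 = D%:Z * b.
  apply: (@intr_inj rat).
  have /(congr1 (fun v : 'rV_(n + 1) => D%:R * v 0 (rshift n 0))) := ab.
  rewrite summxE [in LHS]/ineq_row row_mxEr mxE eqxx mulr1n => ab0.
  rewrite rmorphM /= -[D%:~R]pmulrn ab0 mulr_sumr rmorph_sum.
  apply: eq_bigr => i _.
  by rewrite rmorphMn /= mxE row_mxEr mxE eqxx mulrA DN mulr_natl.
have [|pi [piG sz]] := @derive_sum G g [seq m i | i <- index_enum 'I_k] gG.
  move=> _ /mapP[i _ ->] /=; have : nth (0, 0) s (h i) \in s by rewrite mem_nth.
  by rewrite inE => /predU1P[->|]; [right | left].
rewrite !big_map aE bE => st.
have [//|l lG l_st] := derive_quotient piG _ st.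
exists (rcons pi l); split=> //; last by rewrite mulKz ?intr_eq0 -?lt0n in l_st.
move: sz; rewrite size_rcons size_map [index_enum _]unlock -enumT size_enum_ord.
by rewrite /minn; case: ifP; lia.
Qed.

(** Affine Farkas' lemma. If [G] has no rational point, the row of (a, b) may lie outside the cone,
    but that of 0 <= -1 lies in it. *)
Lemma derive_implied G g a b : g \in G ->
  (forall x : 'cV[rat]_n,
     (forall l, l \in G -> (map_mx intr l.1 *m x) 0 0 <= l.2%:~R) ->
     (map_mx intr a *m x) 0 0 <= b%:~R) ->
  exists pi, [/\ cp_derivation G 1 pi, (size pi <= (minn n (size G)).*2 + 5)%N &
    has_stronger pi (a, b) \/ has_stronger pi (0, -1)].
Proof.
move=> gG Gab; pose s := map ineq_row ((0, 1) :: G).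
have szs : size s = (size G).+1 by rewrite size_map.
have dotE l (c : 'cV[rat]_(n + 1)) : (ineq_row l *m c) 0 0 =
    (map_mx intr l.1 *m usubmx c) 0 0 + l.2%:~R * dsubmx c 0 0.
  by rewrite -{1}[c]vsubmxK mul_row_col mul_scalar_mx mxE [X in _ + X]mxE.
have dotZ (d : 'rV_n) r (u : 'cV[rat]_n) :
    (map_mx intr d *m (r *: u)) 0 0 = r * (map_mx intr d *m u) 0 0.
  by rewrite -scalemxAr mxE.
have s_ge0 (c : 'cV[rat]_(n + 1)) :
    (forall v, v \in s -> 0 <= (v *m c) 0 0) -> 0 <= dsubmx c 0 0 /\
    forall l, l \in G ->
      - (map_mx intr l.1 *m usubmx c) 0 0 <= l.2%:~R * dsubmx c 0 0.
  move=> c_ge0; split=> [|l lG].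
    have := c_ge0 _ (mem_head _ _).
    by rewrite dotE /= map_mx0 mul0mx mxE add0r mul1r.
  by rewrite lerNl -subr_ge0 opprK -dotE c_ge0 // inE map_f ?orbT.
have feasible (c : 'cV[rat]_(n + 1)) :
    (forall v, v \in s -> 0 <= (v *m c) 0 0) -> 0 < dsubmx c 0 0 ->
    forall l, l \in G ->
      (map_mx intr l.1 *m ((- (dsubmx c 0 0)^-1) *: usubmx c)) 0 0 <= l.2%:~R.
  move=> /s_ge0[_ c_G] t_gt0 l /c_G.
  by rewrite dotZ mulNr -mulrN ler_pdivrMl // mulrC.
have [[w w_ge0]|[c c_s]] := farkas s (ineq_row (a, b)).
  rewrite szs => /(derive_cone gG w_ge0)[pi [piG sz st]].
  by exists pi; split=> //; left.
rewrite dotE /= => c_ab; have [t_ge0 c_G] := s_ge0 c c_s.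
(* A separating vector (y, t) with t > 0 yields the point - y / t of [G] violating a x <= b. If t =
   0, then - y is a recession direction of [G] along which a x increases. *)
move: t_ge0; rewrite le_eqVlt => /predU1P[t0|t_gt0]; last first.
  have := Gab _ (feasible c c_s t_gt0).
  rewrite dotZ mulNr -mulrN mulrC ler_pdivrMr //.
  by rewrite lerNl -subr_ge0 opprK leNgt c_ab.
have [[w w_ge0]|[c' c'_s]] := farkas s (ineq_row (0, -1)).
  rewrite szs => /(derive_cone gG w_ge0)[pi [piG sz st]].
  by exists pi; split=> //; right.
rewrite dotE /= map_mx0 mul0mx mxE add0r mulN1r oppr_lt0 => t'_gt0.
have x_G := feasible c' c'_s t'_gt0; set x := _ *: _ in x_G.
rewrite -t0 mulr0 addr0 in c_ab.
(* The step length from [x] at which a x reaches b + 1. *)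
pose r := (b%:~R - (map_mx intr a *m x) 0 0 + 1) /
  - (map_mx intr a *m usubmx c) 0 0.
have r_ge0 : 0 <= r.
  apply: divr_ge0; last by rewrite oppr_ge0 ltW.
  by rewrite addr_ge0 // subr_ge0 Gab.
have lineE (d : 'rV_n) : (map_mx intr d *m (x - r *: usubmx c)) 0 0 =
    (map_mx intr d *m x) 0 0 - r * (map_mx intr d *m usubmx c) 0 0 :> rat.
  by rewrite mulmxBr [LHS]mxE [X in _ + X]mxE (dotZ d r).
have := Gab (x - r *: usubmx c).
rewrite lineE -mulrN divfK ?oppr_eq0 ?lt_eqF //.
move=> contra; exfalso.
have /contra : forall l, l \in G ->
    (map_mx intr l.1 *m (x - r *: usubmx c)) 0 0 <= l.2%:~R.
  move=> l lG; rewrite lineE -mulrN; apply: le_trans (x_G l lG).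
  by rewrite gerDl mulr_ge0_le0 //; have := c_G l lG; rewrite -t0 mulr0.
by lra.
Qed.
End CuttingPlanesDerivations.

(** * Facelike queries on real polyhedra *)

Section FacelikeStabbingPlanes.
Variables (R : realType) (n : nat).
Implicit Types (G : system n) (P Q : set 'cV[R]_n) (a : 'rV[int]_n) (b : int).

Lemma row_affine (c : 'rV[R]_n) (r : R) (x y : 'cV[R]_n) :
  (c *m (x + r *: (y - x))) 0 0 =
  (c *m x) 0 0 + r * ((c *m y) 0 0 - (c *m x) 0 0).
Proof.
rewrite mulmxDr -scalemxAr mulmxBr [LHS]mxE; congr (_ + _).
by rewrite [LHS]mxE [X in _ * X]mxE [X in _ + X]mxE.
Qed.

Lemma lhsN a (x : 'cV[R]_n) : lhs (- a) x = - lhs a x.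
Proof. by rewrite /lhs raddfN mulNmx mxE. Qed.

Lemma polytope_convex G (r : R) x y : 0 <= r <= 1 ->
  @polytope R n G x -> @polytope R n G y -> @polytope R n G (x + r *: (y - x)).
Proof.
move=> /andP[r_ge0 r_le1] Gx Gy l lG; rewrite /lhs row_affine.
by have := Gx l lG; have := Gy l lG; rewrite /lhs; nra.
Qed.

(** The functional defining the face takes the value [delta] at two parameters of the line, hence on
    all of it. *)
Lemma face_line P Q (r : R) x y : is_face P Q -> P y -> Q x -> r != 0 ->
  Q (x + r *: (y - x)) -> Q y.
Proof.
move=> [c [delta [_ _ ->]]] Py [_ /= cx] r_neq0 [_ /=].
rewrite row_affine cx => /eqP.
rewrite -[X in _ == X]addr0 (inj_eq (addrI _)) mulf_eq0 (negPf r_neq0).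
rewrite subr_eq0 => /eqP cy.
by split.
Qed.

(* If both bounds fail, the segment from [x] with [a x < b - 1] to [y] with
   [a y > b] meets either side of the query in more than one point, without
   being contained in it: neither side is then a face. *)
Lemma facelike_bound G a b : facelike_query (@polytope R n G) a b ->
  (forall x, @polytope R n G x -> lhs a x <= b%:~R) \/
  (forall x, @polytope R n G x -> (b - 1)%:~R <= lhs a x).
Proof.
move=> Gab; apply: contrapT => /not_orP[/existsNP[y /not_implyP[Gy yb]]].
move=> /existsNP[x /not_implyP[Gx xb]].
move: yb xb => /negP; rewrite -ltNge => yb /negP; rewrite -ltNge => xb.
have b1 : (b - 1)%:~R = b%:~R - 1 :> R by rewrite rmorphB.
have xb' : lhs a x < b%:~R by rewrite b1 in xb; lra.
have xy : 0 < lhs a y - lhs a x by lra.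
have yx : lhs a x - lhs a y < 0 by lra.
case: Gab => -[empty|face].
- suff: set0 x by [].
  by rewrite -empty; split=> //=; apply: ltW.
- have [_ /=] : (@polytope R n G `&` [set x | lhs a x <= (b - 1)%:~R]) y.
    pose r := ((b - 1)%:~R - lhs a x) / (lhs a y - lhs a x).
    apply: (@face_line _ _ r x _ face Gy).
    + by split=> //; exact: ltW.
    + by apply: mulf_neq0; rewrite ?invr_eq0 gt_eqF // subr_gt0.
    + split; last by rewrite /= /lhs row_affine divfK ?gt_eqF // addrC subrK.
      apply: polytope_convex => //; apply/andP; split.
        by apply: divr_ge0; lra.
      by rewrite ler_pdivrMr // b1; lra.
  by rewrite b1; lra.
- suff: set0 y by [].
  by rewrite -empty; split=> //=; apply: ltW.
- have [_ /=] : (@polytope R n G `&` [set x | b%:~R <= lhs a x]) x.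
    pose r := (b%:~R - lhs a y) / (lhs a x - lhs a y).
    apply: (@face_line _ _ r y _ face Gx).
    + by split=> //; exact: ltW.
    + by apply: mulf_neq0; rewrite ?invr_eq0 lt_eqF // subr_lt0.
    + split; last by rewrite /= /lhs row_affine divfK ?lt_eqF // addrC subrK.
      apply: polytope_convex => //; apply/andP; split.
        by rewrite mulr_le0 ?invr_le0; lra.
      by rewrite ler_ndivrMr //; lra.
  by lra.
Qed.

(** * From Facelike SP to CP *)

(** Rational points embed in the real polytope, so the bound passes to them and Farkas' lemma
    supplies rational multipliers. *)
Lemma derive_polytope_bound G g a b : g \in G ->
  (forall x, @polytope R n G x -> lhs a x <= b%:~R) ->
  exists pi, [/\ cp_derivation G 1 pi, (size pi <= (minn n (size G)).*2 + 5)%N &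
    has_stronger pi (a, b) \/ has_stronger pi (0, -1)].
Proof.
move=> gG Gab; apply: (derive_implied gG) => x Gx.
have ratrE (d : 'rV[int]_n) :
    lhs d (map_mx ratr x) = ratr ((map_mx intr d *m x) 0 0) :> R.
  rewrite /lhs !mxE rmorph_sum; apply: eq_bigr => i _.
  by rewrite !mxE rmorphM /= ratr_int.
rewrite -(ler_rat R) -ratrE ratr_int; apply: Gab => l lG.
by rewrite ratrE -(ratr_int R) ler_rat Gx.
Qed.

(** Only emptiness is kept of a leaf: its real weights need not be rational, and they may be
    numerous. *)
Lemma leaf_polytope G (w : seq R) : leaf_valid G w -> @polytope R n G = set0.
Proof.
move=> [_ w_ge0 wA wb]; rewrite -subset0 => x Gx /=.
have : (\sum_(i < size G) w`_i * lhs (nth (0, 0) G i).1 x : R) <= -1.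
  rewrite -wb; apply: ler_sum => i _; apply: ler_wpM2l; first exact: w_ge0.
  by apply: Gx; rewrite mem_nth.
rewrite (_ : \sum_(i < _) _ = 0) ?oppr_ge0 ?ler10 //; last first.
have /(congr1 (fun u : 'rV_n => (u *m x) 0 0)) := wA.
rewrite /= mul0mx [RHS]mxE mulmx_suml summxE => wx; rewrite -[RHS]wx.
by apply: eq_bigr => i _; rewrite -scalemxAl [RHS]mxE.
Qed.

(* The last line [0 <= -1] of the refutation lifts to [K a x <= K b - 1]; after
   adding [a x <= b] once, to make the factor positive, divide by it. *)
Lemma derive_cut G d0 pi0 a b d pi : cp_derivation G d0 pi0 ->
  has_stronger pi0 (a, b) -> has_stronger pi0 (0, 0) ->
  cp_derivation (rcons G (- a, - b)) d pi -> has_stronger pi (0, -1) ->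
  exists pi', [/\ cp_derivation G (d0 + d).+1 pi', {subset pi0 <= pi'},
    (size pi' <= size pi0 + size pi + d + 2)%N & has_stronger pi' (a, b - 1)].
Proof.
move=> pi0G ab zero piG [[v e] e_pi /= [v0 e_le]]; rewrite {v}v0 in e_pi.
have [l|pi1 [pi1G sub1 sz1 /(_ _ e_pi)[K /= eK]]] :=
  lift_derivation pi0G ab _ piG.
  rewrite mem_rcons inE => /predU1P[->|]; last by left.
  (* With K = 1 the hypothesis - a x <= - b lifts to 0 <= 0. *)
  by right; exists 1%N; rewrite /= !addNr.
have [l2 l2G l2_st] :=
  derive_combination 1 1 pi1G eK (has_stronger_sub sub1 ab).
have [|l3 l3G [l l_in /= [lE le_l]]] :=
  @derive_quotient _ _ _ _ K.+1%:Z a (b *+ K.+1 - 1) l2G isT.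
  case: l2_st => l l_in /= [lE le_l]; exists l => //=; rewrite lE.
  rewrite !mulr1n add0r -mulrSr -scaler_nat natz; split=> //.
  by apply: le_trans le_l _; rewrite !mulr1n mulrSr; lia.
exists (rcons (rcons pi1 l2) l3); split=> //.
- by move=> l' /sub1 ?; do 2!apply: sub_rcons.
- by rewrite !size_rcons; lia.
exists l => //=; split=> //; apply: le_trans le_l _.
rewrite -ltzD1 subrK ltz_divLR // -mulr_natr natz; lia.
Qed.

Lemma derive_query G g a b d1 pi1 d2 pi2 : g \in G ->
  (forall x, @polytope R n G x -> lhs a x <= b%:~R) ->
  cp_derivation (rcons G (a, b - 1)) d1 pi1 -> has_stronger pi1 (0, -1) ->
  cp_derivation (rcons G (- a, - b)) d2 pi2 -> has_stronger pi2 (0, -1) ->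
  exists d pi, [/\ cp_derivation G d pi, (d <= d1 + d2 + 2)%N,
    (size pi <= size pi1 + size pi2 + d1 + d2 + (minn n (size G)).*2 + 8)%N &
    has_stronger pi (0, -1)].
Proof.
move=> gG Gab pi1G [[v e] e_pi /= [v0 e_le]] pi2G st2; rewrite {v}v0 in e_pi.
have [pi0 [pi0G sz0 [ab|st0]]] := derive_polytope_bound gG Gab; last first.
  by exists 1%N, pi0; split=> //; lia.
have [l lG] := derive_combination 0 0 pi0G ab ab.
rewrite !mulr0n !addr0 => zero.
have ab' := has_stronger_sub (@sub_rcons _ pi0 l) ab.
have [pi [piG sub sz [l' l'_pi l'_st]]] := derive_cut lG ab' zero pi2G st2.
have zero' := has_stronger_sub sub zero.
(* Lifting along 0 <= 0 is a plain composition of derivations: the K copies vanish. *)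
have [l''|pi' [pi'G _ sz' /(_ _ e_pi)[K]]] := lift_derivation piG zero' _ pi1G.
  rewrite mem_rcons inE => /predU1P[->|]; last by left.
  by right; exists 0%N; rewrite !addr0; exists l'.
rewrite /= !mul0rn !addr0 => -[l'' l''_pi [l''1 /le_trans l''_le]].
(* Two new divisions: one for a x <= b, one for the cut to a x <= b - 1. *)
exists ((1 + d2).+1 + d1)%N, pi'; split=> //; first by lia.
  by move: sz sz'; rewrite size_rcons; lia.
by exists l'' => //; split=> //; apply: l''_le.
Qed.

(** With s queries the tree has 2 s + 1 nodes, each charged 5 M + 8 lines; a leaf costs one division
    and a query two, hence 3 s + 1. The bound by [M] passes to subtrees, as a query adds one
    inequality and uses up one unit of size. *)
Lemma facelike_derivation M (t : sp_tree R n) G g : g \in G ->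
  sp_valid G t -> facelike G t -> (minn n (size G) + sp_size t <= M)%N ->
  exists d pi, [/\ cp_derivation G d pi, (d <= 3 * sp_size t + 1)%N,
    (size pi <= (2 * sp_size t + 1) * (5 * M + 8))%N & has_stronger pi (0, -1)].
Proof.
elim: t G => [w|a b t1 IH1 t2 IH2] G gG /=.
  move=> /leaf_polytope G0 _ sz.
  have [|pi [piG sz_pi st]] := @derive_polytope_bound G g 0 (-1) gG.
    by rewrite G0.
  exists 1%N, pi; split=> //; last by case: st.
  by apply: leq_trans sz_pi _; rewrite -mul2n; lia.
move=> [v1 v2] [/facelike_bound q f1 f2] sz.
have gG' l : g \in rcons G l by rewrite mem_rcons inE gG orbT.
have [|d1 [pi1 [pi1G d1_le sz1 st1]]] := IH1 _ (gG' _) v1 f1.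
  by move: sz; rewrite size_rcons /minn; do 2!case: ifP; lia.
have [|d2 [pi2 [pi2G d2_le sz2 st2]]] := IH2 _ (gG' _) v2 f2.
  by move: sz; rewrite size_rcons /minn; do 2!case: ifP; lia.
have [d [pi [piG d_le sz_pi st]]] : exists d pi, [/\ cp_derivation G d pi,
    (d <= d1 + d2 + 2)%N, (size pi <=
     size pi1 + size pi2 + d1 + d2 + (minn n (size G)).*2 + 8)%N &
    has_stronger pi (0, -1)].
  case: q => [Gab|Gab]; first exact: (derive_query gG Gab pi1G st1 pi2G st2).
  (* The bound b - 1 <= a x is the previous case for the query (- a, - (b - 1)), which exchanges the
     two branches. *)
  have bE : - b = - (b - 1) - 1 by lia.
  rewrite -[a]opprK -[b - 1]opprK in pi1G; rewrite bE in pi2G.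
  have [x Gx|d [pi [piG d_le sz_pi st]]] := derive_query gG _ pi2G st2 pi1G st1.
    by rewrite lhsN rmorphN lerN2 Gab.
  by exists d, pi; split=> //; lia.
exists d, pi; split=> //; first by lia.
by nia.
Qed.

(** * From CP to Facelike SP *)

(** A node need not contain the CP lines, only have them as conic consequences; linear combinations
    then cost no query. *)
Inductive conic G : 'rV[R]_n -> R -> Prop :=
| conic_mem l : l \in G -> conic G (map_mx intr l.1) l.2%:~R
| conic_comb u v u' v' r r' : conic G u v -> conic G u' v' ->
    0 <= r -> 0 <= r' -> conic G (r *: u + r' *: u') (r * v + r' * v').

Lemma conic_trans G H u v :
  (forall l, l \in G -> conic H (map_mx intr l.1) l.2%:~R) ->
  conic G u v -> conic H u v.
Proof.
move=> GH; elim=> [l /GH //|{}u {}v u' v' r r' _ IHu _ IHu' r0 r'0].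
exact: conic_comb.
Qed.

Lemma conic_sound G u v x :
  conic G u v -> @polytope R n G x -> (u *m x) 0 0 <= v.
Proof.
move=> + Gx; elim=> [l lG|{}u {}v u' v' r r' _ IHu _ IHu' r_ge0 r'_ge0].
  exact: Gx.
rewrite mulmxDl -!scalemxAl [leLHS]mxE [X in X + _]mxE [X in _ + X]mxE.
by rewrite lerD // ler_wpM2l.
Qed.

Lemma conic_weights G u v : conic G u v -> exists w : nat -> R,
  [/\ forall i, 0 <= w i,
      \sum_(i < size G) w i *: map_mx intr (nth (0, 0) G i).1 = u &
      \sum_(i < size G) w i * (nth (0, 0) G i).2%:~R = v].
Proof.
elim=> [l lG|{}u {}v u' v' r r' _ [w [w0 wA wb]]
    _ [w' [w'0 w'A w'b]] r0 r'0].
  exists (fun i => (i == index l G)%:R); split=> [i||]; first exact: ler0n.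
    have iG : (index l G < size G)%N by rewrite index_mem.
    rewrite (bigD1 (Ordinal iG)) //= eqxx scale1r nth_index // big1 ?addr0 //.
    by move=> i; rewrite -val_eqE /= => /negPf->; rewrite scale0r.
  have iG : (index l G < size G)%N by rewrite index_mem.
  rewrite (bigD1 (Ordinal iG)) //= eqxx mul1r nth_index // big1 ?addr0 //.
  by move=> i; rewrite -val_eqE /= => /negPf->; rewrite mul0r.
exists (fun i => r * w i + r' * w' i); split=> [i||].
- by rewrite addr_ge0 ?mulr_ge0.
- rewrite -wA -w'A !scaler_sumr -big_split; apply: eq_bigr => i _ /=.
  by rewrite scalerDl !scalerA.
- rewrite -wb -w'b !mulr_sumr -big_split; apply: eq_bigr => i _ /=.
  by rewrite mulrDl !mulrA.
Qed.

Lemma conic_leaf G v : v < 0 -> conic G 0 v -> exists w : seq R, leaf_valid G w.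
Proof.
move=> v_lt0 /conic_weights[w [w_ge0 wA wb]].
(* Rescaling turns the constant [v] into the -1 required at a leaf. *)
exists (mkseq (fun i => - v^-1 * w i) (size G)); split.
- by rewrite size_mkseq.
- by move=> i iG; rewrite nth_mkseq // mulr_ge0 // oppr_ge0 invr_le0 ltW.
- under eq_bigr => i _ do rewrite nth_mkseq // -scalerA.
  by rewrite -scaler_sumr wA scaler0.
- under eq_bigr => i _ do rewrite nth_mkseq // -mulrA.
  by rewrite -mulr_sumr wb mulNr mulVf // lt_eqF.
Qed.

(** The proof is peeled from its end while the tree grows from its root, hence the continuation: it
    refutes every system with all of [F ++ pi] as conic consequences. Each line peeled off adds at
    most one query. *)
Lemma cp_facelike F pi : cp_proof F pi -> forall k,
  (forall G, (forall l, l \in F ++ pi -> conic G (map_mx intr l.1) l.2%:~R) ->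
   exists2 t : sp_tree R n, facelike_sp_refutation G t & (sp_size t <= k)%N) ->
  forall G, (forall l, l \in F -> conic G (map_mx intr l.1) l.2%:~R) ->
  exists2 t : sp_tree R n, facelike_sp_refutation G t &
    (sp_size t <= k + size pi)%N.
Proof.
elim=> { pi} [|pi l _ IH pi_l] k Hk G FG.
  by rewrite addn0; apply: Hk => l; rewrite cats0; apply: FG.
rewrite size_rcons -addSnnS; apply: IH FG => {}G Gpi.
have step H :
    (forall l', l' \in F ++ pi -> conic H (map_mx intr l'.1) l'.2%:~R) ->
    conic H (map_mx intr l.1) l.2%:~R ->
    exists2 t : sp_tree R n, facelike_sp_refutation H t & (sp_size t <= k)%N.
  move=> Hpi Hl; apply: Hk => l'.
  by rewrite -rcons_cat mem_rcons inE => /predU1P[->|/Hpi].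
have skip : conic G (map_mx intr l.1) l.2%:~R -> exists2 t : sp_tree R n,
    facelike_sp_refutation G t & (sp_size t <= k.+1)%N.
  by move=> /(step _ Gpi)[t Gt t_le]; exists t => //; apply: leqW.
case: pi_l => [lF|[[l1 [l2 [i [j [l1_pi l2_pi lE]]]]]|
    [l1 [e [l1_pi e_gt0 e_dvd lE]]]]].
- by apply: skip; apply: Gpi; rewrite mem_cat lF.
- apply: skip; rewrite lE /= !raddfD !raddfMn -!scaler_nat.
  rewrite -[l1.2%:~R *+ i]mulr_natl -[l2.2%:~R *+ j]mulr_natl.
  apply: conic_comb; rewrite ?ler0n //; apply: Gpi.
    by rewrite mem_cat l1_pi orbT.
  by rewrite mem_cat l2_pi orbT.
have l1G : conic G (map_mx intr l1.1) l1.2%:~R.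
  by apply: Gpi; rewrite mem_cat l1_pi orbT.
have l1E : l1.1 = e *: l.1.
  by apply/rowP=> i; rewrite lE !mxE mulrC divzK.
(* As [l.2] is the floor of l1.2 / e, the line [l1] contradicts the right branch l.1 x >= l.2 + 1;
   the leaf adds l1 / e to that inequality. *)
have l1_lt : l1.2%:~R < e%:~R * (l.2 + 1)%:~R :> R.
  by rewrite -rmorphM ltr_int lE /= mulrC ltz_ceil.
have sub_G l' v u : conic G u v -> conic (rcons G l') u v.
  move=> Guv; apply: conic_trans Guv => l'' l''G.
  by apply: conic_mem; apply: sub_rcons.
have e_gt0' : 0 < e%:~R :> R by rewrite ltr0z.
have [||t [t_valid t_face] t_le] := step (rcons G (l.1, l.2 + 1 - 1)).
- by move=> l' /Gpi; apply: sub_G.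
- rewrite addrK -surjective_pairing; apply: conic_mem; exact: mem_rcons_last.
have [||w w_valid] := @conic_leaf (rcons G (- l.1, - (l.2 + 1)))
    (e%:~R^-1 * l1.2%:~R + 1 * (- (l.2 + 1))%:~R).
- by rewrite mul1r rmorphN subr_lt0 ltr_pdivrMl.
- have -> : 0 = e%:~R^-1 *: map_mx intr l1.1 +
      1 *: map_mx intr (- l.1) :> 'rV[R]_n.
    apply/rowP => i; rewrite l1E !mxE rmorphM rmorphN /= mulKf ?gt_eqF //.
    by rewrite mul1r subrr.
  apply: conic_comb; rewrite ?invr_ge0 ?(ltW e_gt0') //; first exact: sub_G.
  apply: (@conic_mem _ (- l.1, - (l.2 + 1))); exact: mem_rcons_last.
exists (sp_query l.1 (l.2 + 1) t (sp_leaf _ w)); last by rewrite /= addn0.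
split; split=> //; right; left; rewrite -subset0 => x [Gx /=].
apply/negP; rewrite -ltNge.
rewrite -(ltr_pM2l e_gt0'); apply: le_lt_trans l1_lt.
have := conic_sound l1G Gx; congr (_ <= _).
rewrite l1E /lhs !mxE mulr_sumr; apply: eq_bigr => i _.
by rewrite !mxE rmorphM mulrA.
Qed.
End FacelikeStabbingPlanes.

(* The size of a refutation does not account for the system: an infeasible
   linear program has an SP refutation with no query, while a CP refutation may
   have to use n + 1 of its inequalities, one per line. Hence the term
   [minn n (size F)], without which the second bound would be false. *)
Theorem theorem1p1 (R : realType) :
  (exists p : {poly nat},
     forall (n : nat) (F : system n), unsatisfiable F ->
     forall pi : seq (ineq n), cp_refutation F pi ->
     exists t : sp_tree R n,
       facelike_sp_refutation F t /\
       (sp_size t <= p.[cp_size pi]%R)%N)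
  /\
  (exists p : {poly nat},
     forall (n : nat) (F : system n), unsatisfiable F ->
     forall t : sp_tree R n, facelike_sp_refutation F t ->
     exists pi : seq (ineq n),
       cp_refutation F pi /\
       (cp_size pi <= p.[(sp_size t + minn n (size F))%N]%R)%N).
Proof.
split.
  exists 'X => n F _ pi [piF [pi' piE]].
  (* Once all lines are available, the last one closes a leaf without any query. *)
  have [G Gpi|t Ft t_le] := cp_facelike piF (k := 0) _ (@conic_mem R n F).
    have [||w Gw] := @conic_leaf R n G (-1).
    - by rewrite ltrN10.
    - have := Gpi (0, -1); rewrite mem_cat piE mem_rcons_last orbT map_mx0.
      by apply.
    by exists (sp_leaf _ w).
  by exists t; split=> //; rewrite hornerX.
exists ((2%:P * 'X + 1%:P) * (5%:P * 'X + 8%:P) + 1%:P).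
move=> n F unsatF t [t_valid t_face].
have [g gF] : exists g, g \in F.
  case: F unsatF {t_valid t_face} => [unsatF|g F _].
    by case: unsatF; exists 0.
  by exists g; rewrite mem_head.
have [|d [pi [piG d_le sz st]]] :=
    facelike_derivation (M := (sp_size t + minn n (size F))%N)
      gF t_valid t_face.
  by rewrite addnC.
case: st => -[v b] b_pi /= [v0 b_le]; rewrite {v}v0 in b_pi.
(* The derivation reaches 0 <= b with b <= -1; one more division, by - b, gives exactly 0 <= -1. *)
exists (rcons pi (0, -1)); split.
  split; last by exists pi.
  apply: cp_rcons (cp_derivation_proof piG) _; right; right.
  exists (0, b), (- b); split=> //.
  - by lia.
  - by move=> i; rewrite mxE dvdz0.
  - congr (_, _); first by apply/rowP=> i; rewrite !mxE div0z.
    have b_neq0 : b != 0 by lia.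
    by rewrite /= divzN divzz b_neq0.
rewrite /cp_size size_rcons; set M := (_ + minn _ _)%N in sz *.
rewrite (_ : _.[M] = (2 * M + 1) * (5 * M + 8) + 1)%N; last first.
  by rewrite !(hornerD, hornerM, hornerX, hornerC).
by rewrite addn1 ltnS (leq_trans sz) // leq_mul // leq_add2r leq_mul2l leq_addr.
Qed.
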